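(* Let $G=(V,E)$ be a finite simple undirected graph, $c:E\to\mathbb{R}_{\ge 0}$ a capacity function, $s,t\in V$, and $w\in\mathbb{R}$. Then the number of orientations of $G$ whose resulting digraph admits an $s$-$t$ flow of value at least $w$ equals the number of subsets $X\subseteq E$ such that the undirected graph $(V,X)$ (with capacities $c$ restricted to $X$) admits an $s$-$t$ flow of value at least $w$.
   Context: An orientation of $G$ assigns a direction to each edge. In a digraph, flow along an arc goes only in its direction and is bounded by its capacity; in an undirected graph, each edge $e$ may carry flow in either direction, of magnitude at most $c(e)$. *)

(* Defs.v *)
From mathcomp Require Import all_boot all_order all_algebra.
From mathcomp Require Import boolp reals.

Set Implicit Arguments.
Unset Strict Implicit.
Unset Printing Implicit Defensive.

Import Order.TTheory GRing.Theory Num.Theory.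
Local Open Scope ring_scope.

(* The edge {x, y} of a simple graph on the vertex type V is the set
   [set x; y], so the graph is its set E of two-element vertex sets. *)
Definition simple_graph (V : finType) (E : {set {set V}}) : Prop :=
  forall e : {set V}, e \in E -> #|e| = 2%N.

(* An orientation is represented by its set A of arcs (tail, head). *)
Definition is_orientation (V : finType) (E : {set {set V}})
    (A : {set V * V}) : bool :=
  [forall x, forall y,
    if [set x; y] \in E then ((x, y) \in A) (+) ((y, x) \in A)
    else (x, y) \notin A].

Section Flows.
Variables (R : realType) (V : finType) (c : {set V} -> R) (s t : V).

Definition dnet_out (A : {set V * V}) (f : V * V -> R) (v : V) : R :=
  \sum_(a in A | a.1 == v) f a - \sum_(a in A | a.2 == v) f a.

(* For s = t the value is the net outflow at s, which conservation at all
   other vertices forces to be 0. *)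
Definition is_dflow (A : {set V * V}) (f : V * V -> R) : Prop :=
  (forall a, a \in A -> 0 <= f a <= c [set a.1; a.2]) /\
  (forall v, v != s -> v != t -> dnet_out A f v = 0).

Definition admits_dflow (A : {set V * V}) (w : R) : Prop :=
  exists f : V * V -> R, is_dflow A f /\ w <= dnet_out A f s.

(* f x y is the signed amount carried by the edge {x, y} from x to y. *)
Definition unet_out (X : {set {set V}}) (f : V -> V -> R) (v : V) : R :=
  \sum_(y | [set v; y] \in X) f v y.

Definition is_uflow (X : {set {set V}}) (f : V -> V -> R) : Prop :=
  (forall x y, [set x; y] \in X ->
     f y x = - f x y /\ `|f x y| <= c [set x; y]) /\
  (forall v, v != s -> v != t -> unet_out X f v = 0).

Definition admits_uflow (X : {set {set V}}) (w : R) : Prop :=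
  exists f : V -> V -> R, is_uflow X f /\ w <= unet_out X f s.

End Flows.

(* Main.v *)
Require Import Defs.
From mathcomp Require Import all_boot all_order all_algebra.
From mathcomp Require Import boolp reals.
From mathcomp Require Import lra.

Set Implicit Arguments.
Unset Strict Implicit.
Unset Printing Implicit Defensive.

Import Order.TTheory GRing.Theory Num.Theory.
Local Open Scope ring_scope.

(** Describe a flow by one signed number per edge, relative to a fixed reference
    direction.  An edge of capacity [c] confines this number to [[0, c]] or
    [[-c, 0]] when it is oriented, to [[-c, c]] when it is kept undirected and to
    [{0}] when it is deleted.  With the states of all other edges fixed, the
    feasible flows form a convex set.  It meets [[-c, c]] iff it meets [[0, c]] or
    [[-c, 0]], and, by taking a convex combination that vanishes on the edge, it
    meets [{0}] iff it meets both [[0, c]] and [[-c, 0]].  Hence the edge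
    contributes equally often with "two orientations" as with "kept or deleted",
    and the edges can be switched from one regime to the other one at a time. *)

(** * Convexity and the states of a single edge *)

Definition convex_pred (R : realFieldType) (T : Type) (K : (T -> R) -> Prop) :=
  forall (g h : T -> R) (a b : R), 0 <= a -> 0 <= b -> a + b = 1 ->
    K g -> K h -> K (fun e => a * g e + b * h e).

(** With [m] and [p] the truth values on the left, those on the right are [m && p] and [m || p], and
    both pairs have the same sum. *)
Lemma convex_coordinate_count (R : realFieldType) (T : Type)
    (L : (T -> R) -> Prop) (e : T) (c : R) :
  convex_pred L -> 0 <= c ->
  (`[< exists g, L g /\ (0 <= - g e <= c)%R >] +
   `[< exists g, L g /\ (0 <= g e <= c)%R >] =
   `[< exists g, L g /\ g e == 0%R >] +
   `[< exists g, L g /\ (`|g e| <= c)%R >])%N.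
Proof.
move=> cvxL c0.
set m := `[< _ >]; set p := `[< _ >]; set z := `[< _ >]; set u := `[< _ >].
have -> : u = m || p.
  apply/asboolP/orP => [[g [Lg]]|[/asboolP|/asboolP] [g [Lg gc]]].
  - rewrite ler_norml => /andP[g1 g2]; have [g0|g0] := leP 0 (g e).
      by right; apply/asboolP; exists g; rewrite g0.
    by left; apply/asboolP; exists g; split=> //; apply/andP; split; lra.
  - by exists g; split=> //; rewrite ler_norml; apply/andP; split; lra.
  - by exists g; split=> //; rewrite ler_norml; apply/andP; split; lra.
have -> : z = m && p; last by case: (m); case: (p).
apply/asboolP/andP => [[g [Lg /eqP g0]]|[]].
  by split; apply/asboolP; exists g; rewrite g0 ?oppr0 lexx.
move=> /asboolP[g [Lg /andP[g0 _]]] /asboolP[h [Lh /andP[h0 _]]].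
have [g00|gN0] := eqVneq (g e) 0; first by exists g; rewrite g00 eqxx.
have d0 : 0 < h e - g e by move: gN0; rewrite neq_lt => /orP[]; lra.
(* The weights are proportional to [h e] and [- g e], so that the two contributions at [e]
   cancel. *)
exists (fun x => h e / (h e - g e) * g x + - g e / (h e - g e) * h x); split.
  apply: cvxL => //; [exact: divr_ge0 h0 (ltW d0)|exact: divr_ge0 g0 (ltW d0)|].
  by rewrite -mulrDl divff // gt_eqF.
by apply/eqP; rewrite -!(mulrAC _ _ (_^-1)) -mulrDl mulNr (mulrC (h e)) subrr mul0r.
Qed.

(* Admissible signed flows on an edge of capacity [c]: if [sub], the edge is
   kept or deleted according to [b]; otherwise it is oriented with or against
   the reference direction according to [b]. *)
Definition edge_adm (R : realFieldType) (sub b : bool) (c x : R) : bool :=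
  match sub, b with
  | true, true => `|x| <= c
  | true, false => x == 0
  | false, true => 0 <= x <= c
  | false, false => 0 <= - x <= c
  end.

Lemma edge_adm_convex (R : realFieldType) (sub b : bool) (c x y p q : R) :
  0 <= p -> 0 <= q -> p + q = 1 ->
  edge_adm sub b c x -> edge_adm sub b c y -> edge_adm sub b c (p * x + q * y).
Proof.
move=> p0 q0 pq; have qE : q = 1 - p by lra.
rewrite {q pq}qE in q0 *.
by case: sub b => [] [] /=; rewrite ?ler_norml;
  [move=> /andP[? ?] /andP[? ?]; apply/andP; split; nra
  |move=> /eqP-> /eqP->; rewrite !mulr0 addr0
  |move=> /andP[? ?] /andP[? ?]; apply/andP; split; nra
  |move=> /andP[? ?] /andP[? ?]; apply/andP; split; nra].
Qed.

(** * Switching the edges from one regime to the other *)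

Section MixedRegime.
Variables (R : realFieldType) (T : finType) (E : {set T}) (c : T -> R).
Variable K : (T -> R) -> Prop.
Hypothesis K_convex : convex_pred K.
Hypothesis c_ge0 : forall e, e \in E -> 0 <= c e.

(** [S] holds the edges already switched to the kept-or-deleted regime. [B] records one binary
    choice per edge, read as a direction outside [S] and as presence inside [S]. *)
Definition mixed_adm (S B : {set T}) : Prop :=
  exists g, K g /\ forall e, e \in E -> edge_adm (e \in S) (e \in B) (c e) (g e).

Lemma sum_subsets_pair (h : {set T} -> nat) (e : T) : e \in E ->
  (\sum_(B : {set T} | B \subset E) h B =
   \sum_(B : {set T} | (B \subset E) && (e \notin B)) (h B + h (e |: B)))%N.
Proof.
move=> eE; rewrite big_split /= (bigID (fun B : {set T} => e \in B)) /= addnC.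
congr (_ + _)%N.
rewrite (reindex_onto (fun B => e |: B) (fun B => B :\ e)) /=; last first.
  by move=> B /andP[_ eB]; rewrite setD1K.
apply: eq_bigl => B; rewrite setU11 andbT subUset sub1set eE /=.
congr (_ && _); apply/eqP/idP => [<-|]; first by rewrite setD11.
exact: setU1K.
Qed.

Lemma mixed_adm_switch (S B : {set T}) (e : T) :
  e \in E -> e \notin S -> e \notin B ->
  (`[< mixed_adm S B >] + `[< mixed_adm S (e |: B) >] =
   `[< mixed_adm (e |: S) B >] + `[< mixed_adm (e |: S) (e |: B) >])%N.
Proof.
move=> eE eS eB.
(* [L] gathers every constraint except the one at [e]; it is convex and common to all four terms. *)
pose L g := K g /\
  forall x, x \in E -> x != e -> edge_adm (x \in S) (x \in B) (c x) (g x).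
have cvxL : convex_pred L.
  move=> g h a b a0 b0 ab [Kg Lg] [Kh Lh]; split; first exact: K_convex.
  by move=> x xE xe; apply: edge_adm_convex => //; [apply: Lg|apply: Lh].
have mixedL (S' B' : {set T}) : (forall x, x != e -> (x \in S') = (x \in S)) ->
    (forall x, x != e -> (x \in B') = (x \in B)) ->
    mixed_adm S' B' <->
    exists g, L g /\ edge_adm (e \in S') (e \in B') (c e) (g e).
  move=> eqS eqB; split=> [[g [Kg gP]]|[g [[Kg gP] ge]]]; exists g.
    by split; [split=> // x xE xe; rewrite -eqS// -eqB//; apply: gP|exact: gP].
  split=> // x xE; have [->//|xe] := eqVneq x e.
  by rewrite eqS// eqB//; apply: gP.
have addE (C : {set T}) x : x != e -> (x \in e |: C) = (x \in C).
  by rewrite in_setU1 => /negPf->.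
rewrite (asbool_equiv_eq (mixedL S B _ _)) //.
rewrite (asbool_equiv_eq (mixedL S (e |: B) _ (addE B))) //.
rewrite (asbool_equiv_eq (mixedL (e |: S) B (addE S) _)) //.
rewrite (asbool_equiv_eq (mixedL (e |: S) (e |: B) (addE S) (addE B))).
rewrite !setU11 (negPf eS) (negPf eB) /=.
exact: convex_coordinate_count cvxL (c_ge0 eE).
Qed.

Lemma mixed_adm_count :
  #|[set B : {set T} | (B \subset E) && `[< mixed_adm set0 B >]]| =
  #|[set B : {set T} | (B \subset E) && `[< mixed_adm E B >]]|.
Proof.
have cardE S : #|[set B : {set T} | (B \subset E) && `[< mixed_adm S B >]]| =
    (\sum_(B : {set T} | B \subset E) `[< mixed_adm S B >])%N.
  by rewrite -sum1dep_card -big_mkcondr.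
have chain (s : seq T) : uniq s -> {subset s <= E} ->
    (\sum_(B : {set T} | B \subset E) `[< mixed_adm set0 B >] =
     \sum_(B : {set T} | B \subset E) `[< mixed_adm [set x in s] B >])%N.
  elim: s => [|e s IHs] /=; first by rewrite set_nil.
  move=> /andP[es us] sE; have eE : e \in E by apply: sE; rewrite mem_head.
  rewrite IHs// => [|x xs]; last by apply: sE; rewrite in_cons xs orbT.
  (* Switching [e] may change single terms; only the sum over each pair [B], [e |: B] is
     preserved. *)
  rewrite set_cons !(sum_subsets_pair _ eE); apply: eq_bigr => B /andP[_ eB].
  by apply: mixed_adm_switch => //; rewrite inE.
rewrite !cardE (chain (enum E)) ?enum_uniq ?set_enum// => x.
by rewrite mem_enum.
Qed.

End MixedRegime.

(** * Signed edge values relative to a reference direction *)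

Section ReferenceDirection.
Variables (R : realType) (V : finType).

Definition ref_dir (x y : V) : bool := (enum_rank x < enum_rank y)%N.

Lemma ref_dirC (x y : V) : x != y -> ref_dir y x = ~~ ref_dir x y.
Proof.
move=> xy; rewrite /ref_dir -leqNgt [RHS]leq_eqVlt.
by case: eqP => // yx; rewrite (enum_rank_inj (ord_inj yx)) eqxx in xy.
Qed.

Lemma ref_dir_asym (x y : V) : ref_dir x y -> ref_dir y x = false.
Proof. by move=> xy; apply/negbTE; rewrite -leqNgt ltnW. Qed.

Lemma ref_dir_uniq (x y a b : V) : ref_dir x y -> ref_dir a b ->
  [set x; y] = [set a; b] -> (x, y) = (a, b).
Proof.
move=> xy ab /setP eq_e.
have xNy : x != y by apply: contraTneq xy => ->; rewrite /ref_dir ltnn.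
have: x \in [set a; b] by rewrite -eq_e set21.
have: y \in [set a; b] by rewrite -eq_e set22.
rewrite !inE => /orP[]/eqP yE /orP[]/eqP xE; subst x y => //.
- by rewrite eqxx in xNy.
- by rewrite (ref_dir_asym ab) in xy.
- by rewrite eqxx in xNy.
Qed.

Definition signed_flow (g : {set V} -> R) (x y : V) : R :=
  if ref_dir x y then g [set x; y] else - g [set x; y].

Lemma signed_flowN (g : {set V} -> R) (x y : V) : x != y ->
  signed_flow g y x = - signed_flow g x y.
Proof.
move=> xy; rewrite /signed_flow (ref_dirC xy) setUC.
by case: ref_dir => //=; rewrite opprK.
Qed.

Lemma signed_flow_surj (f : V -> V -> R) : exists g : {set V} -> R,
  forall x y, x != y -> f y x = - f x y -> signed_flow g x y = f x y.
Proof.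
(* On an edge this sum has exactly one term, the value of [f] in the reference direction, so no
   endpoints need to be chosen. *)
pose g (e : {set V}) :=
  \sum_(p : V * V | ref_dir p.1 p.2 && (e == [set p.1; p.2])) f p.1 p.2.
have gE x y : ref_dir x y -> g [set x; y] = f x y.
  move=> xy; rewrite /g (big_pred1 (x, y)) // => -[a b] /=.
  apply/andP/eqP => [[ab /eqP/esym e_eq]|[-> ->]]; last by rewrite xy.
  exact: ref_dir_uniq e_eq.
exists g => x y xy fN; rewrite /signed_flow; case: ifPn => [/gE//|nxy].
by rewrite setUC gE ?fN ?opprK // ref_dirC.
Qed.

Lemma unet_out_signed_flow_linear (E : {set {set V}}) (g h : {set V} -> R)
    (a b : R) (v : V) :
  unet_out E (signed_flow (fun e => a * g e + b * h e)) v =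
  a * unet_out E (signed_flow g) v + b * unet_out E (signed_flow h) v.
Proof.
rewrite /unet_out !mulr_sumr -big_split /=; apply: eq_bigr => y _.
by rewrite /signed_flow; case: ref_dir => //; rewrite opprD !mulrN.
Qed.

End ReferenceDirection.

(** * Undirected and directed flows as signed edge values *)

Section FlowTranslation.
Variables (R : realType) (V : finType) (E : {set {set V}}).
Hypothesis simpleE : simple_graph E.
Variables (c : {set V} -> R) (s t : V) (w : R).

(** The part of the flow conditions that is independent of the choice at each edge; capacities and
    directions are left to [edge_adm]. *)
Definition conserving (g : {set V} -> R) : Prop :=
  (forall v, v != s -> v != t -> unet_out E (signed_flow g) v = 0) /\
  w <= unet_out E (signed_flow g) s.

Lemma conserving_convex : convex_pred conserving.
Proof.
move=> g h a b a0 b0 ab [g0 gw] [h0 hw]; split=> [v vs vt|].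
  by rewrite unet_out_signed_flow_linear g0// h0// !mulr0 addr0.
rewrite unet_out_signed_flow_linear -[w]mul1r -ab mulrDl.
by rewrite lerD// ler_wpM2l.
Qed.

Lemma edge_neq (x y : V) : [set x; y] \in E -> x != y.
Proof.
by move=> /simpleE; rewrite cards2; case: eqVneq.
Qed.

Lemma edge_refP (e : {set V}) : e \in E ->
  exists x y, [/\ ref_dir x y & e = [set x; y]].
Proof.
move=> eE; have /eqP/cards2P[x [y [xy eE2]]] := simpleE eE.
have [xy'|nxy] := boolP (ref_dir x y); first by exists x, y.
by exists y, x; rewrite ref_dirC // setUC.
Qed.

(** A flow on [X] extends by zero to [E]; conversely, edges outside [X] carry zero and drop out of
    every net outflow. *)
Lemma admits_uflow_mixed (X : {set {set V}}) : X \subset E ->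
  admits_uflow c s t X w <-> mixed_adm E c conserving E X.
Proof.
move=> /subsetP XE; split=> [[f [[fP f0] fw]]|[g [[g0 gw] gP]]].
  pose f' x y := if [set x; y] \in X then f x y else 0.
  have [g gf] := signed_flow_surj f'.
  have f'N x y : f' y x = - f' x y.
    rewrite /f' (setUC [set y]); case: ifPn => [/fP[]//|_].
    by rewrite oppr0.
  have gE x y : [set x; y] \in E -> signed_flow g x y = f' x y.
    by move=> xyE; apply: gf => //; exact: edge_neq.
  have netE v : unet_out E (signed_flow g) v = unet_out X f v.
    rewrite /unet_out (eq_bigr (f' v)) => [|y]; last exact: gE.
    rewrite -big_mkcondr; apply: eq_bigl => y.
    by apply: andb_idl; exact: XE.
  exists g; split.
    by split=> [v vs vt|]; rewrite netE//; exact: f0.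
  move=> e eE; rewrite eE; have [x [y [xy eE2]]] := edge_refP eE.
  have := gE x y; rewrite -eE2 /signed_flow xy /f' -eE2 => -> //.
  case: ifPn => [eX|eX] /=; last by rewrite eqxx.
  by move: eX; rewrite eE2 => /fP[].
have gX0 x y : [set x; y] \in E -> [set x; y] \notin X ->
    signed_flow g x y = 0.
  move=> eE eX; have := gP _ eE; rewrite eE (negPf eX) /= => /eqP g00.
  by rewrite /signed_flow g00 oppr0 if_same.
have netE v : unet_out X (signed_flow g) v = unet_out E (signed_flow g) v.
  rewrite /unet_out [RHS](bigID (fun y => [set v; y] \in X)) /=.
  rewrite [X in _ + X]big1 => [|y /andP[]]; last exact: gX0.
  rewrite addr0; apply: eq_bigl => y; apply/esym/andb_idl; exact: XE.
exists (signed_flow g); split; last by rewrite netE.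
split=> [x y xyX|v vs vt]; last by rewrite netE; exact: g0.
have xyE := XE _ xyX; split; first exact: signed_flowN _ (edge_neq xyE).
have := gP _ xyE; rewrite xyE xyX /= /signed_flow.
by case: ref_dir; rewrite ?normrN.
Qed.

Lemma is_orientationE (A : {set V * V}) (x y : V) : is_orientation E A ->
  [set x; y] \in E -> ((y, x) \in A) = ((x, y) \notin A).
Proof.
move=> /forallP/(_ x)/forallP/(_ y) + xyE; rewrite xyE.
by case: (_ \in A); case: (_ \in A).
Qed.

Lemma is_orientation_sub (A : {set V * V}) (x y : V) : is_orientation E A ->
  (x, y) \in A -> [set x; y] \in E.
Proof.
by move=> /forallP/(_ x)/forallP/(_ y); case: ifP => // _ /negPf->.
Qed.

Definition arc_flow (A : {set V * V}) (f : V * V -> R) (x y : V) : R :=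
  (if (x, y) \in A then f (x, y) else 0) - (if (y, x) \in A then f (y, x) else 0).

Lemma dnet_out_arc_flow (A : {set V * V}) (f : V * V -> R) (v : V) :
  is_orientation E A -> dnet_out A f v = unet_out E (arc_flow A f) v.
Proof.
move=> orA; rewrite /unet_out big_mkcond /=.
under eq_bigr => y _.
  have -> : (if [set v; y] \in E then arc_flow A f v y else 0) = arc_flow A f v y.
    case: ifPn => // vyE; rewrite /arc_flow.
    rewrite (contraNF (is_orientation_sub orA) vyE).
    rewrite (contraNF (is_orientation_sub orA)) ?subr0//.
    by rewrite setUC.
  over.
rewrite /= sumrB /dnet_out; congr (_ - _).
- rewrite -big_mkcond /= (reindex_onto (fun y => (v, y)) snd) /=.
    by apply: eq_bigl => y; rewrite !eqxx !andbT.
  by move=> [a b] /andP[_ /= /eqP->].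
- rewrite -big_mkcond /= (reindex_onto (fun y => (y, v)) fst) /=.
    by apply: eq_bigl => y; rewrite !eqxx !andbT.
  by move=> [a b] /andP[_ /= /eqP->].
Qed.

(** Edges in [B] follow the reference direction, the others oppose it. This is a bijection from
    subsets of [E] to orientations. *)
Definition orientation_of (B : {set {set V}}) : {set V * V} :=
  [set a | ([set a.1; a.2] \in E) &&
           (ref_dir a.1 a.2 == ([set a.1; a.2] \in B))].

Lemma orientation_ofP (B : {set {set V}}) : is_orientation E (orientation_of B).
Proof.
apply/forallP => x; apply/forallP => y; rewrite !inE /= (setUC [set y]).
case: (boolP ([set x; y] \in E)) => //= xyE; rewrite (ref_dirC (edge_neq xyE)).
by case: ref_dir; case: (_ \in B).
Qed.

Lemma orientation_of_inj :
  {in [pred B : {set {set V}} | B \subset E] &, injective orientation_of}.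
Proof.
move=> B C /subsetP BE /subsetP CE /setP BC; apply/setP => e.
have [eE|eE] := boolP (e \in E); last first.
  by rewrite (contraNF (BE e) eE) (contraNF (CE e) eE).
have [x [y [xy eE2]]] := edge_refP eE.
have := BC (x, y); rewrite !inE /= -eE2 eE xy /=.
by case: (e \in B); case: (e \in C).
Qed.

Lemma orientation_of_surj (A : {set V * V}) : is_orientation E A ->
  exists2 B : {set {set V}}, B \subset E & A = orientation_of B.
Proof.
move=> orA.
(* [B] consists of the edges that [A] directs along the reference direction. *)
pose B := [set e in E | [exists x, exists y,
  [&& ref_dir x y, e == [set x; y] & (x, y) \in A]]].
exists B; first by apply/subsetP => e; rewrite inE => /andP[].
have BE x y : ref_dir x y -> [set x; y] \in E ->
    ([set x; y] \in B) = ((x, y) \in A).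
  move=> xy xyE; rewrite inE xyE /=.
  apply/existsP/idP => [[a /existsP[b /and3P[ab /eqP eq_e abA]]]|xyA].
    by rewrite (ref_dir_uniq xy ab eq_e).
  by exists x; apply/existsP; exists y; rewrite xy eqxx.
apply/setP => -[x y]; rewrite /orientation_of in_set /=.
have [xyE|xyE] := boolP ([set x; y] \in E); last first.
  by rewrite (contraNF (is_orientation_sub orA) xyE).
rewrite /=; have [xy|nxy] := boolP (ref_dir x y); first by rewrite BE.
have yxE : [set y; x] \in E by rewrite setUC.
rewrite (setUC [set x]) BE ?(ref_dirC (edge_neq xyE))//.
by rewrite (is_orientationE orA xyE); case: (_ \in A).
Qed.

(** Each edge has a single arc, whose flow is the signed value if the edge is in [B] and its
    negative otherwise; the bounds on the arc become those of [edge_adm]. *)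
Lemma admits_dflow_mixed (B : {set {set V}}) :
  admits_dflow c s t (orientation_of B) w <->
  mixed_adm E c conserving set0 B.
Proof.
have orA := orientation_ofP B; set A := orientation_of B in orA *.
have memA x y : ref_dir x y -> [set x; y] \in E ->
    (((x, y) \in A) = ([set x; y] \in B)) *
    (((y, x) \in A) = ([set x; y] \notin B)).
  move=> xy xyE; have: ((x, y) \in A) = ([set x; y] \in B).
    by rewrite inE /= xyE xy; case: (_ \in B).
  by move=> eA; rewrite (is_orientationE orA xyE) eA.
split=> [[f [[fP f0] fw]]|[g [[g0 gw] gP]]].
  have [g gf] := signed_flow_surj (arc_flow A f).
  have gE x y : [set x; y] \in E -> signed_flow g x y = arc_flow A f x y.
    by move=> xyE; apply: gf; [exact: edge_neq|rewrite /arc_flow opprB].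
  have netE v : unet_out E (signed_flow g) v = dnet_out A f v.
    by rewrite dnet_out_arc_flow//; apply: eq_bigr => y; exact: gE.
  exists g; split.
    by split=> [v vs vt|]; rewrite netE//; exact: f0.
  move=> e eE; rewrite inE; have [x [y [xy eE2]]] := edge_refP eE.
  rewrite {e}eE2 in eE *; have [xyA yxA] := memA x y xy eE.
  have := gE x y eE; rewrite /signed_flow xy /arc_flow xyA yxA => ->.
  case: ifPn => [eB|eB] /=.
    by rewrite subr0; apply: (fP (x, y)); rewrite xyA.
  rewrite sub0r opprK (setUC [set x]); apply: (fP (y, x)).
  by rewrite yxA.
pose f (a : V * V) := signed_flow g a.1 a.2.
have netE v : dnet_out A f v = unet_out E (signed_flow g) v.
  rewrite dnet_out_arc_flow//; apply: eq_bigr => y vyE.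
  rewrite /arc_flow (is_orientationE orA vyE) /f /=.
  case: ifP => _ /=; first by rewrite subr0.
  by rewrite sub0r (signed_flowN _ (edge_neq vyE)) opprK.
exists f; split; last by rewrite netE.
split=> [[x y]|v vs vt]; last by rewrite netE; exact: g0.
rewrite inE /= => /andP[xyE /eqP xyB].
have := gP _ xyE; rewrite inE -xyB /f /signed_flow /=.
by case: ref_dir.
Qed.

End FlowTranslation.

Theorem theorem4p2 (R : realType) (V : finType) (E : {set {set V}})
    (simpleE : simple_graph E)
    (c : {set V} -> R) (c_ge0 : forall e : {set V}, e \in E -> 0 <= c e)
    (s t : V) (w : R) :
  #|[set A : {set V * V} |
      is_orientation E A && `[< admits_dflow c s t A w >]]| =
  #|[set X : {set {set V}} |
      (X \subset E) && `[< admits_uflow c s t X w >]]|.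
Proof.
(* Through [orientation_of], counting orientations becomes counting subsets of [E] with no edge
   switched. *)
have -> : [set A | is_orientation E A && `[< admits_dflow c s t A w >]] =
    orientation_of E @: [set B : {set {set V}} | (B \subset E) &&
      `[< mixed_adm E c (conserving E s t w) set0 B >]].
  apply/setP => A; rewrite inE; apply/andP/imsetP.
    move=> [/(orientation_of_surj simpleE)[B BE ->] /asboolP adm].
    exists B => //; rewrite inE BE /=; apply/asboolP.
    exact/(admits_dflow_mixed simpleE).
  move=> [B + ->]; rewrite inE => /andP[BE /asboolP adm].
  split; first exact: orientation_ofP.
  by apply/asboolP/(admits_dflow_mixed simpleE).
rewrite card_in_imset; last first.
  move=> B C; rewrite !inE => /andP[BE _] /andP[CE _].
  exact: (orientation_of_inj simpleE).
(* All edges are switched here; the remaining sets agree member by member. *)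
rewrite (mixed_adm_count (@conserving_convex _ _ E s t w) c_ge0).
apply: eq_card => X; rewrite !inE; apply: andb_id2l => XE.
by apply/esym/asbool_equiv_eq/admits_uflow_mixed.
Qed.
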